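(* Let $\sigma=1-\frac{\alpha}{2}\in(\frac12,1)$ and let $U_h^0,U_h^1,\dots,U_h^N\in V^k_{0,h}$ be a solution of the L2-$1_\sigma$-NIPG fully discrete scheme, i.e. for every $0\leq n\leq N-1$ and every $v_h\in V^k_{0,h}$, $$\lambda_1\left(\delta_tU_h^{n,\sigma},v_h\right)+\lambda_2\left(\delta^\alpha_{n+\sigma}U_h,v_h\right)+B_h\left(U_h^{n,\sigma},v_h\right)=\left(f^{n+\sigma},v_h\right).$$ Then $$\|U_h^1\|^2\leq\left(1+\frac{\lambda_2}{\lambda_1}\omega_{2-\alpha}(t_\sigma)\right)\|U_h^0\|^2+\frac{\tau}{2\lambda_1\gamma_2}\|f^\sigma\|^2,$$ and for all $1\leq n\leq N-1$, $$\|U_h^{n+1}\|^2\leq\left[3+\frac{\lambda_2}{\lambda_1}\omega_{2-\alpha}(t_{n+\sigma})\left(5+\frac{\lambda_2}{\lambda_1}\omega_{2-\alpha}(t_\sigma)\right)\right]\|U_h^0\|^2+\frac{2\tau}{\lambda_1\gamma_2}\left[\left(1+\frac{\lambda_2}{4\lambda_1}\omega_{2-\alpha}(t_{n+\sigma})\right)\|f^\sigma\|^2+\sum_{i=1}^{n}\|f^{i+\sigma}\|^2\right].$$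
   Context: Constants: $\alpha\in(0,1)$, $L,T>0$, $\lambda_1,\lambda_2,\gamma_1,\gamma_2>0$; $\Omega=(0,L)$; $f\in C^0([0,T];L^2(\Omega))$. Write $\omega_\beta(t)=t^{\beta-1}/\Gamma(\beta)$ for $\beta>0$. The scheme discretizes the problem $\lambda_1 u_t+\lambda_2\,{}_C\mathrm{D}^\alpha_{0,t}u-\gamma_1u_{xx}+\gamma_2u=f$ on $\Omega\times(0,T]$ with $u(x,0)=\phi(x)$ and $u(0,t)=u(L,t)=0$, where ${}_C\mathrm{D}^\alpha_{0,t}$ is the Caputo derivative in time. Space mesh: $M\in\mathbb N$, $h=L/M$, $x_m=mh$ ($0\leq m\leq M$), $K_m=(x_m,x_{m+1})$ ($0\leq m\leq M-1$). For a fixed integer $k\geq1$, $V^k_{0,h}$ is the space of $w\in L^2(\Omega)$ whose restriction to each $K_m$ is a polynomial of degree at most $k$ and which vanish on $\partial\Omega=\{0,L\}$ (no continuity at interior nodes is required). At interior nodes, $w_m^\pm=w(x_m\pm0)$, jump $[w]_m=w_m^+-w_m^-$, average $\{w\}_m=\frac12(w_m^++w_m^-)$. Jumps at $m=0$ and $m=M$ are zero for functions vanishing on $\partial\Omega$, so the boundary terms in the sums below vanish. $(w_1,w_2)=\sum_{m=0}^{M-1}\int_{K_m}w_1w_2\,dx$ and $\|\cdot\|$ is the $L^2(\Omega)$ norm. Bilinear form: with penalty parameters $\varsigma_m>0$ and derivatives taken elementwise, $$B_h(w,v)=\gamma_1\left(\tfrac{\partial w}{\partial x},\tfrac{\partial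 v}{\partial x}\right)+\gamma_2(w,v)+\gamma_1\sum_{m=0}^{M}\left(\left\{\tfrac{\partial w}{\partial x}\right\}_m[v]_m-\left\{\tfrac{\partial v}{\partial x}\right\}_m[w]_m\right)+\sum_{m=0}^{M}\frac{\varsigma_m}{h}[w]_m[v]_m .$$ Time mesh: $N\in\mathbb N$, $\tau=T/N$, $t_n=n\tau$, $t_{n+\sigma}=(n+\sigma)\tau$ (so $t_\sigma=\sigma\tau$), $f^{n+\sigma}=f(\cdot,t_{n+\sigma})$, $f^\sigma=f(\cdot,t_\sigma)$. For a sequence $(v^n)$: $\delta v^n=v^{n+1}-v^n$, $v^{n,\sigma}=\sigma v^{n+1}+(1-\sigma)v^n$, $$\delta_tv^{0,\sigma}=\frac{\delta v^0}{\tau},\qquad \delta_tv^{n,\sigma}=\frac{2\sigma+1}{2\tau}\delta v^n-\frac{2\sigma-1}{2\tau}\delta v^{n-1}\quad(1\leq n\leq N-1),$$ $$\delta^\alpha_{n+\sigma}v=\sum_{j=0}^{n}g_j^n\,\delta v^{n-j}\quad(0\leq n\leq N-1),$$ where $a_0=\frac1\tau\omega_{2-\alpha}(t_\sigma)$, $b_0=0$, and for $j\geq1$ $$a_j=\frac1\tau\left[\omega_{2-\alpha}(t_{j+\sigma})-\omega_{2-\alpha}(t_{j-1+\sigma})\right],$$ $$b_j=\frac1{\tau^2}\left[\omega_{3-\alpha}(t_{j+\sigma})-\omega_{3-\alpha}(t_{j-1+\sigma})\right]-\frac1{2\tau}\left[\omega_{2-\alpha}(t_{j+\sigma})+\omega_{2-\alpha}(t_{j-1+\sigma})\right],$$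 and $g_0^0=a_0$, while for $n\geq1$: $g_j^n=a_j+b_{j+1}-b_j$ for $0\leq j\leq n-1$, and $g_n^n=a_n-b_n$. *)

(* Defs.v *)
From HB Require Import structures.
From mathcomp Require Import all_boot all_order all_algebra.
From mathcomp Require Import all_classical all_reals all_analysis.

Set Implicit Arguments.
Unset Strict Implicit.
Unset Printing Implicit Defensive.

Import Order.TTheory GRing.Theory Num.Theory.
Import numFieldNormedType.Exports.

Local Open Scope classical_set_scope.
Local Open Scope ring_scope.

(* Euler's Gamma function, meaningful for x > 0. *)
Definition Gamma (R : realType) (x : R) : R :=
  \int[lebesgue_measure]_(t in `]0, +oo[) (t `^ (x - 1) * expR (- t)).

Definition omega (R : realType) (beta t : R) : R := t `^ (beta - 1) / Gamma beta.

(* Functions of the space variable are total functions R -> R of which only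
   the values on Omega = ]0, L[ matter, hence the restriction to Omega, which
   extends them by 0. *)
Definition inL2 (R : realType) (L : R) (w : R -> R) : Prop :=
  (w \_ `]0, L[) \in Lfun (@lebesgue_measure R) 2%:E.

Definition L2norm (R : realType) (L : R) (w : R -> R) : R :=
  fine 'N[@lebesgue_measure R]_2%:E[EFin \o (w \_ `]0, L[)%R]%E.

(* f \in C^0([0, T]; L^2(Omega)), with f t the function of space at time t *)
Definition continuousL2 (R : realType) (L T : R) (f : R -> R -> R) : Prop :=
  (forall t : R, t \in `[0, T] -> inL2 L (f t)) /\
  (forall s : R, s \in `[0, T] ->
     (fun t => L2norm L (f t \- f s)) @ within `[0, T] (nbhs s) --> (0 : R)).

Definition mesh_size (R : realType) (L : R) (M : nat) : R := L / M%:R.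

Definition node (R : realType) (L : R) (M m : nat) : R := m%:R * mesh_size L M.

Definition cell (R : realType) (L : R) (M m : nat) : set R :=
  `]node L M m, node L M m.+1[.

(* The discontinuous finite element space V^k_{0,h}; the boundary condition is
   understood in the sense of traces, and the values of w at the nodes are
   irrelevant. *)
Definition inV (R : realType) (L : R) (M k : nat) (w : R -> R) : Prop :=
  [/\ inL2 L w,
      forall m, (m < M)%N -> exists2 p : {poly R}, (size p <= k.+1)%N &
        forall x, cell L M m x -> w x = p.[x],
      w x @[x --> (0 : R)^'+] --> (0 : R) &
      w x @[x --> L^'-] --> (0 : R)].

Definition inner (R : realType) (L : R) (M : nat) (w1 w2 : R -> R) : R :=
  \sum_(m < M) \int[lebesgue_measure]_(x in cell L M m) (w1 x * w2 x).

(* One-sided traces at the nodes.  The traces taken from outside Omega, at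
   m = 0 from the left and at m = M from the right, are set to 0, so that the
   jumps of the elements of V^k_{0,h} vanish at m = 0 and m = M. *)
Definition trace_plus (R : realType) (L : R) (M : nat) (w : R -> R) (m : nat)
    : R :=
  if m == M then 0 else lim (w x @[x --> (node L M m)^'+]).

Definition trace_minus (R : realType) (L : R) (M : nat) (w : R -> R) (m : nat)
    : R :=
  if m == 0%N then 0 else lim (w x @[x --> (node L M m)^'-]).

Definition jump (R : realType) (L : R) (M : nat) (w : R -> R) (m : nat) : R :=
  trace_plus L M w m - trace_minus L M w m.

Definition average (R : realType) (L : R) (M : nat) (w : R -> R) (m : nat)
    : R :=
  (trace_plus L M w m + trace_minus L M w m) / 2.

(* derive1 w and derive1 v are elementwise derivatives: they are only used in
   the open cells, and through one-sided limits at the nodes. *)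
Definition Bh (R : realType) (L : R) (M : nat) (gamma1 gamma2 : R)
    (vsigma : nat -> R) (w v : R -> R) : R :=
  gamma1 * inner L M (derive1 w) (derive1 v) + gamma2 * inner L M w v
  + gamma1 * \sum_(m < M.+1) (average L M (derive1 w) m * jump L M v m
                              - average L M (derive1 v) m * jump L M w m)
  + \sum_(m < M.+1) vsigma m / mesh_size L M * jump L M w m * jump L M v m.

Definition tsig (R : realType) (sigma tau : R) (n : nat) : R :=
  (n%:R + sigma) * tau.

Definition delta (R : realType) (v : nat -> R -> R) (n : nat) : R -> R :=
  fun x => v n.+1 x - v n x.

Definition theta_avg (R : realType) (sigma : R) (v : nat -> R -> R) (n : nat)
    : R -> R :=
  fun x => sigma * v n.+1 x + (1 - sigma) * v n x.

Definition delta_t (R : realType) (sigma tau : R) (v : nat -> R -> R) (n : nat)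
    : R -> R :=
  fun x =>
  if n is n'.+1 then (2 * sigma + 1) / (2 * tau) * delta v n x
                     - (2 * sigma - 1) / (2 * tau) * delta v n' x
  else delta v 0 x / tau.

Definition coef_a (R : realType) (alpha sigma tau : R) (j : nat) : R :=
  if j is j'.+1 then
    tau^-1 * (omega (2 - alpha) (tsig sigma tau j)
              - omega (2 - alpha) (tsig sigma tau j'))
  else tau^-1 * omega (2 - alpha) (tsig sigma tau 0).

Definition coef_b (R : realType) (alpha sigma tau : R) (j : nat) : R :=
  if j is j'.+1 then
    (tau ^+ 2)^-1 * (omega (3 - alpha) (tsig sigma tau j)
                     - omega (3 - alpha) (tsig sigma tau j'))
    - (2 * tau)^-1 * (omega (2 - alpha) (tsig sigma tau j)
                      + omega (2 - alpha) (tsig sigma tau j'))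
  else 0.

(* g_j^n, meant for j <= n *)
Definition coef_g (R : realType) (alpha sigma tau : R) (n j : nat) : R :=
  let a := coef_a alpha sigma tau in
  let b := coef_b alpha sigma tau in
  if n == 0%N then a 0%N
  else if (j < n)%N then a j + b j.+1 - b j
  else a n - b n.

Definition delta_alpha (R : realType) (alpha sigma tau : R)
    (v : nat -> R -> R) (n : nat) : R -> R :=
  fun x =>
  \sum_(j < n.+1) coef_g alpha sigma tau n j * delta v (n - j)%N x.

Definition nipg_solution (R : realType) (alpha sigma L T : R) (M N k : nat)
    (lambda1 lambda2 gamma1 gamma2 : R) (vsigma : nat -> R)
    (f : R -> R -> R) (U : nat -> R -> R) : Prop :=
  let tau := T / N%:R in
  (forall n, (n <= N)%N -> inV L M k (U n)) /\
  (forall n, (n < N)%N -> forall v, inV L M k v ->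
     lambda1 * inner L M (delta_t sigma tau U n) v
     + lambda2 * inner L M (delta_alpha alpha sigma tau U n) v
     + Bh L M gamma1 gamma2 vsigma (theta_avg sigma U n) v
     = inner L M (f (tsig sigma tau n)) v).

(* Main.v *)
Require Import Defs.
From mathcomp Require Import all_boot all_order all_algebra.
From mathcomp Require Import all_classical all_reals all_analysis.
From mathcomp Require Import measurable_realfun.
From mathcomp Require Import ring lra.

Import Order.TTheory GRing.Theory Num.Theory.
Import numFieldNormedType.Exports.

Local Open Scope classical_set_scope.
Local Open Scope ring_scope.

Set Implicit Arguments.
Unset Strict Implicit.
Unset Printing Implicit Defensive.

(* Test the scheme with [U^{n,sigma}]: the bilinear form controls [gamma2] times
   the squared norm, which absorbs the source by Young's inequality.  The local
   difference quotient dominates the increment of the energy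
   [H^n = (2s+1)|U^{n+1}|^2 - (2s-1)|U^n|^2 + (2s-1)(s+1)|U^{n+1}-U^n|^2], up to
   the square [s(2s-1)|U^{n+1}-2U^n+U^{n-1}|^2].  The memory term dominates
   [1/2 sum_j g_j^n (|U^{n+1-j}|^2 - |U^{n-j}|^2)] as soon as
   [g_1^n >= ... >= g_n^n >= 0] and [s^2 g_1^n <= (2s-1) g_0^n]; these follow from
   [b_j] being the (scaled) error of the trapezoidal rule on [omega_{2-alpha}].
   The sums telescope because only the last two weights of [g^{n+1}] differ from
   those of [g^n], so that just [U^0] and [U^1] are left over, and
   [tau (a_0 + ... + a_n) = omega_{2-alpha}(t_{n+s})].  Finally the first step
   yields the factor [1 + mu omega_{2-alpha}(t_s)], [mu = lambda2/lambda1], in front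
   of [|U^1|^2 - |U^0|^2], which is exactly what absorbs the coefficient of
   [|U^1|^2]. *)

(** * Monotonicity and the trapezoidal rule *)

Section monotonicity.
Context {R : realType}.
Implicit Types (P p r : R -> R) (c x y : R).

(** Regularity is asked on the open half-line only, since the powers of t used as kernels may be
    singular at 0. The weak bounds on [z] admit the degenerate case [x = y]. *)
Lemma MVT_pos P p x y :
  (forall t : R, 0 < t -> is_derive t 1 P (p t)) -> 0 < x -> x <= y ->
  exists2 z, x <= z <= y & P y - P x = p z * (y - x).
Proof.
move=> dP x0 xy.
have dP' t : t \in `]x, y[ -> is_derive t 1 P (p t).
  by rewrite in_itv/= => /andP[xt _]; apply: dP; exact: lt_trans xt.
have cP : {within `[x, y], continuous P}.
  apply: derivable_within_continuous => t; rewrite in_itv/= => /andP[xt _].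
  by have [] := dP _ (lt_le_trans x0 xt).
have [z + ->] := MVT_segment xy dP' cP.
by rewrite in_itv/=; exists z.
Qed.

Lemma derive_le0_nincr P p x y :
  (forall t : R, 0 < t -> is_derive t 1 P (p t)) -> 0 < x -> x <= y ->
  (forall t, x <= t -> p t <= 0) -> P y <= P x.
Proof.
move=> dP x0 xy p0; have [z /andP[xz _] e] := MVT_pos dP x0 xy.
by rewrite -subr_le0 e mulr_le0_ge0 ?p0// subr_ge0.
Qed.

(* Integrating a convex function [p] by the trapezoidal rule overestimates. *)
Lemma trapezoid_ge P p r c h :
  (forall t : R, 0 < t -> is_derive t 1 P (p t)) ->
  (forall t : R, 0 < t -> is_derive t 1 p (r t)) ->
  (forall x y, 0 < x -> x <= y -> r x <= r y) ->
  0 < c -> 0 <= h ->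
  P (c + h) - P c <= h / 2 * (p (c + h) + p c).
Proof.
move=> dP dp rnd c0 h0.
(* The right end point is made variable. [G] has derivative (p x - p c)/2 - (x - c)/2 r x, which is
   nonpositive because p x - p c = r z (x - c) for some z <= x. *)
pose G x := P x - (x - c) / 2 * (p x + p c).
suff: G (c + h) <= G c by rewrite /G; lra.
apply: (@derive_le0_nincr _
  (fun x => p x - (2^-1 * (p x + p c) + (x - c) / 2 * r x))) => //.
- move=> t t0; have ? := dP t t0; have ? := dp t t0.
  by apply: is_derive_eq; rewrite /GRing.scale/=; ring.
- by rewrite lerDl.
- move=> t ct.
  have [z /andP[cz zt] e] := MVT_pos dp c0 ct.
  have : r z * (t - c) <= r t * (t - c).
    by rewrite ler_wpM2r ?subr_ge0 ?rnd// (lt_le_trans c0).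
  rewrite -e; lra.
Qed.

Lemma is_derive_shift P p c : 0 <= c ->
  (forall t : R, 0 < t -> is_derive t 1 P (p t)) ->
  forall t : R, 0 < t -> is_derive t 1 (fun x => P (x + c)) (p (t + c)).
Proof.
move=> c0 dP t t0.
have ? : is_derive (t + c) 1 P (p (t + c)) by apply: dP; rewrite ltr_wpDr.
have ? : is_derive t 1 (fun x => x + c) 1.
  by apply: is_derive_eq; rewrite addr0.
rewrite -[p (t + c)]mulr1.
exact: (@is_derive1_comp R P (fun x => x + c)).
Qed.

End monotonicity.

(* [Wi] stands for [omega (i - alpha)]; at [t = t_{j-1+sigma}] the quantities
   [increment t] and [trapezoid_defect t] are [a_j] and [b_j]. *)
Section kernel.
Context {R : realType}.
Implicit Types x y t : R.
Variables (W3 W2 W1 W0 : R -> R) (tau : R).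
Hypothesis tau0 : 0 < tau.
Hypothesis dW3 : forall t : R, 0 < t -> is_derive t 1 W3 (W2 t).
Hypothesis dW2 : forall t : R, 0 < t -> is_derive t 1 W2 (W1 t).
Hypothesis dW1 : forall t : R, 0 < t -> is_derive t 1 W1 (W0 t).
Hypothesis W1_ge0 : forall t : R, 0 < t -> 0 <= W1 t.
Hypothesis W0_le0 : forall t : R, 0 < t -> W0 t <= 0.
Hypothesis W0_nd : forall x y : R, 0 < x -> x <= y -> W0 x <= W0 y.

Definition increment (t : R) := tau^-1 * (W2 (t + tau) - W2 t).

Definition trapezoid_defect (t : R) :=
  (tau ^+ 2)^-1 * (W3 (t + tau) - W3 t)
  - (2 * tau)^-1 * (W2 (t + tau) + W2 t).

Let W1_ni x y : 0 < x -> x <= y -> W1 y <= W1 x.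
Proof.
move=> x0 xy; apply: (derive_le0_nincr dW1) => // t xt.
by apply: W0_le0; exact: lt_le_trans xt.
Qed.

Let W2_nd x y : 0 < x -> x <= y -> W2 x <= W2 y.
Proof.
move=> x0 xy; have [z /andP[xz _] e] := MVT_pos dW2 x0 xy.
by rewrite -subr_ge0 e mulr_ge0 ?subr_ge0// W1_ge0// (lt_le_trans x0).
Qed.

Let tauN0 : tau != 0. Proof. by rewrite gt_eqF. Qed.

(** [W2] is concave because [W1] is nonincreasing, so the trapezoidal rule underestimates its
    integral; the convex case is applied to the opposite functions. *)
Lemma trapezoid_defect_ge0 t : 0 < t -> 0 <= trapezoid_defect t.
Proof.
move=> t0.
have := @trapezoid_ge _ (fun x => - W3 x) (fun x => - W2 x) (fun x => - W1 x)
  t tau _ _ _ t0 (ltW tau0).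
have -> : trapezoid_defect t = (tau ^+ 2)^-1 *
   ((W3 (t + tau) - W3 t) - tau / 2 * (W2 (t + tau) + W2 t)).
  by rewrite /trapezoid_defect; field.
move=> H; rewrite mulr_ge0 ?invr_ge0 ?sqr_ge0//.
suff : - W3 (t + tau) - - W3 t <= tau / 2 * (- W2 (t + tau) - W2 t) by lra.
apply: H => [x x0|x x0|x y x0 xy].
- by have ? := dW3 x0; apply: is_derive_eq.
- by have ? := dW2 x0; apply: is_derive_eq.
- by rewrite lerN2 W1_ni.
Qed.

(** As [W2] is nondecreasing, its mean over [t, t + tau] is at most its value at the right end,
    which exceeds the average of the two end values by half the difference. *)
Lemma trapezoid_defect_le t : 0 < t -> trapezoid_defect t <= increment t / 2.
Proof.
move=> t0; have tt : t <= t + tau by rewrite lerDl ltW.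
have [z /andP[tz zt] e] := MVT_pos dW3 t0 tt.
have zW : W2 z <= W2 (t + tau) by rewrite W2_nd// (lt_le_trans t0).
rewrite -subr_ge0.
have -> : increment t / 2 - trapezoid_defect t = tau^-1 * (W2 (t + tau) - W2 z).
  by rewrite /trapezoid_defect e /increment; field.
by rewrite mulr_ge0 ?invr_ge0 ?subr_ge0// ltW.
Qed.

Lemma is_derive_increment t : 0 < t ->
  is_derive t 1 increment (tau^-1 * (W1 (t + tau) - W1 t)).
Proof.
move=> t0; have ? := dW2 t0.
have ? := is_derive_shift (ltW tau0) dW2 t0.
by apply: is_derive_eq; rewrite /GRing.scale/=; ring.
Qed.

Lemma is_derive_trapezoid_defect t : 0 < t ->
  is_derive t 1 trapezoid_defect ((tau ^+ 2)^-1 * (W2 (t + tau) - W2 t)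
    - (2 * tau)^-1 * (W1 (t + tau) + W1 t)).
Proof.
move=> t0; have ? := dW2 t0; have ? := dW3 t0.
have ? := is_derive_shift (ltW tau0) dW2 t0.
have ? := is_derive_shift (ltW tau0) dW3 t0.
by apply: is_derive_eq; rewrite /GRing.scale/=; ring.
Qed.

(** The derivative of the defect is again a scaled trapezoidal error, now for [W1]. That function is
    convex, so the error has the opposite sign. *)
Lemma trapezoid_defect_nincr x y : 0 < x -> x <= y ->
  trapezoid_defect y <= trapezoid_defect x.
Proof.
move=> x0 xy; apply: (derive_le0_nincr is_derive_trapezoid_defect) => // t xt.
have t0 : 0 < t := lt_le_trans x0 xt.
have H := trapezoid_ge dW2 dW1 W0_nd t0 (ltW tau0).
rewrite [leLHS](_ : _ = (tau ^+ 2)^-1 *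
    (W2 (t + tau) - W2 t - tau / 2 * (W1 (t + tau) + W1 t))); last by field.
by rewrite mulr_ge0_le0 ?invr_ge0 ?sqr_ge0// subr_le0.
Qed.

Lemma increment_le t : 0 < t -> increment t <= W1 t.
Proof.
move=> t0; have tt : t <= t + tau by rewrite lerDl ltW.
have [z /andP[tz zt] e] := MVT_pos dW2 t0 tt.
rewrite /increment e (_ : t + tau - t = tau); last by ring.
rewrite mulrCA mulVf// mulr1.
exact: W1_ni.
Qed.

Lemma increment_ge t : 0 < t -> W1 (t + tau) <= increment t.
Proof.
move=> t0; have tt : t <= t + tau by rewrite lerDl ltW.
have [z /andP[tz zt] e] := MVT_pos dW2 t0 tt.
rewrite /increment e (_ : t + tau - t = tau); last by ring.
rewrite mulrCA mulVf// mulr1.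
by apply: W1_ni => //; exact: lt_le_trans tz.
Qed.

(** Up to the factor 1/tau, the derivative is half of W1(t + tau) - W1(t) minus the excess of the
    increment over W1(t + tau). Both contributions are nonpositive because [W1] is nonincreasing. *)
Lemma increment_sub_defect_nincr x y : 0 < x -> x <= y ->
  increment y - trapezoid_defect y <= increment x - trapezoid_defect x.
Proof.
move=> x0 xy.
apply: (@derive_le0_nincr _ (fun t => increment t - trapezoid_defect t)
  (fun t => tau^-1 * (W1 (t + tau) - W1 t)
     - ((tau ^+ 2)^-1 * (W2 (t + tau) - W2 t)
        - (2 * tau)^-1 * (W1 (t + tau) + W1 t)))) => //.
  move=> t t0; have ? := is_derive_increment t0.
  by have ? := is_derive_trapezoid_defect t0; apply: is_derive_eq.
move=> t xt; have t0 : 0 < t := lt_le_trans x0 xt.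
rewrite [leLHS](_ : _ = tau^-1 * (2^-1 * (W1 (t + tau) - W1 t)
     - (increment t - W1 (t + tau)))); last by rewrite /increment; field.
rewrite mulr_ge0_le0 ?invr_ge0 ?(ltW tau0)// subr_le0.
rewrite (@le_trans _ _ 0)// ?subr_ge0 ?increment_ge//.
by rewrite mulr_ge0_le0// subr_le0 W1_ni// lerDl ltW.
Qed.

End kernel.

(** * The functional equation of Gamma *)

Section Gamma.
Context {R : realType}.
Implicit Types s t : R.
Local Notation mu := (@lebesgue_measure R).

Lemma Gamma_ge0 s : 0 <= Gamma s.
Proof.
by apply: Rintegral_ge0 => t _; rewrite mulr_ge0 ?powR_ge0 ?expR_ge0.
Qed.

(** Raise t/(s + 1) <= exp(t/(s + 1)) to the power s + 1. The remaining factor 1/t gives the decay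
    at infinity. *)
Lemma powR_expRN_le s t : 0 < s -> 0 < t ->
  t `^ s * expR (- t) <= (s + 1) `^ (s + 1) * t^-1.
Proof.
move=> s0 t0; have s1 : 0 < s + 1 by rewrite addr_gt0.
have e0 := expR_gt0 (t / (s + 1)).
have H : t `^ (s + 1) <= (s + 1) `^ (s + 1) * expR t.
  have -> : expR t = (expR (t / (s + 1))) `^ (s + 1).
    by rewrite -expRM mulfVK ?gt_eqF//.
  rewrite -powRM ?(ltW s1) ?(ltW e0)//.
  apply: ge0_ler_powR;
    rewrite ?nnegrE ?(ltW s1) ?(ltW t0) ?mulr_ge0 ?(ltW s1) ?(ltW e0)//.
  rewrite mulrC -ler_pdivrMr//; apply/ltW; apply: lt_le_trans (expR_ge1Dx _).
  by rewrite ltrDr.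
rewrite expRN ler_pdivrMr ?expR_gt0// mulrAC ler_pdivlMr//.
by rewrite -{2}(powRr1 (ltW t0)) -powRD// (gt_eqF s1).
Qed.

Lemma powR_expRN_cvg s : 0 < s -> t `^ s * expR (- t) @[t --> +oo] --> 0.
Proof.
move=> s0; set C := (s + 1) `^ (s + 1).
apply: (@squeeze_cvgr _ _ _ _ (cst 0) (fun t => C * t^-1)).
- near=> t; rewrite mulr_ge0 ?powR_ge0 ?expR_ge0//= powR_expRN_le//.
- exact: cvg_cst.
- by rewrite -(mulr0 C); apply: cvgMr; by apply/gtr0_cvgV0 => //; exact: nbhs_pinfty_gt.
Unshelve. all: by end_near. Qed.

(* [t^s e^-t - s t^(s-1) e^-t] changes sign on [0, +oo[; adding [s^s e^-t] makes
   it nonnegative, so that no integrability has to be established. *)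
Lemma GammaS s : 1 < s -> Gamma (s + 1) = s * Gamma s.
Proof.
move=> s1; have s0 : 0 < s := lt_trans ltr01 s1.
have sB0 : 0 < s - 1 by rewrite subr_gt0.
pose C := s `^ s.
have C0 : 0 <= C by exact: powR_ge0.
pose e t := expR (- t).
pose h t := t `^ s * e t.
pose k t := t `^ (s - 1) * e t.
pose f t := h t - s * k t + C * e t.
have e0 t : 0 <= e t by exact: expR_ge0.
have h0 t : 0 <= h t by rewrite mulr_ge0 ?powR_ge0.
have k0 t : 0 <= k t by rewrite mulr_ge0 ?powR_ge0.
have me : measurable_fun [set: R] e.
  exact: measurableT_comp.
have mh : measurable_fun [set: R] h.
  by apply: measurable_funM => //; exact: measurable_powR.
have mk : measurable_fun [set: R] k.
  by apply: measurable_funM => //; exact: measurable_powR.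
have de t : is_derive t 1 e (- e t).
  by rewrite /e; apply: is_derive_eq; rewrite /GRing.scale/= mulrN1.
have ce t : {for t, continuous e}.
  by apply: differentiable_continuous; apply/derivable1_diffP; have [] := de t.
have dh t : 0 < t -> is_derive t 1 h (s * k t - h t).
  move=> t0; have ? := de t; have ? := is_derive1_powR s t0.
  by apply: is_derive_eq; rewrite /GRing.scale/= /h /k; ring.
have cp a : 0 < a -> (fun t : R => t `^ a) x @[x --> 0^'+] --> (0 : R) `^ a.
  by move=> a0; rewrite powR0 ?gt_eqF//; exact: powR_cvg0.
have ce0 : e x @[x --> 0^'+] --> e 0 by apply: cvg_at_right_filter; exact: ce.
have ch0 : h x @[x --> 0^'+] --> h 0 by apply: cvgM => //; exact: cp.
have ck0 : k x @[x --> 0^'+] --> k 0 by apply: cvgM => //; exact: cp.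
have ey : e x @[x --> +oo] --> (0 : R) by exact: cvgr_expR.
have hy : h x @[x --> +oo] --> (0 : R) by exact: powR_expRN_cvg.
have hz : h 0 = 0 by rewrite /h powR0 ?gt_eqF// mul0r.
have ez : e 0 = 1 by rewrite /e oppr0 expR0.
have f0 t : 0 <= t -> 0 <= f t.
  move=> t0.
  have -> : f t = ((t - s) * t `^ (s - 1) + C) * e t.
    have tS : t `^ s = t * t `^ (s - 1).
      by rewrite mulr_powRB1.
    by rewrite /f /h /k tS; ring.
  rewrite mulr_ge0//.
  (* Only t < s needs the constant: there s t^(s-1) <= s s^(s-1) = C. *)
  have [st|ts] := leP s t.
    by rewrite addr_ge0// mulr_ge0 ?powR_ge0 ?subr_ge0.
  have : t `^ (s - 1) <= s `^ (s - 1).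
    by apply: ge0_ler_powR;
      rewrite ?nnegrE ?(ltW sB0) ?(ltW ts) ?(ltW s0).
  have -> : C = s * s `^ (s - 1).
    by rewrite mulr_powRB1// ltW.
  move/(ler_wpM2l (ltW s0)) => H.
  have : 0 <= t * t `^ (s - 1) by rewrite mulr_ge0 ?powR_ge0.
  by rewrite mulrBl; lra.
have cf : {within `[0, +oo[, continuous f}.
  apply/continuous_within_itvcyP; split.
    move=> t; rewrite in_itv/= andbT => t0.
    have ch : {for t, continuous h}.
      apply: differentiable_continuous; apply/derivable1_diffP.
      by have [] := dh _ t0.
    have ck : {for t, continuous k}.
      suff cpw : {for t, continuous (fun x : R => x `^ (s - 1))}.
        by apply: cvgM; [exact: cpw|exact: ce].
      apply: differentiable_continuous; apply/derivable1_diffP.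
      by have [] := is_derive1_powR (s - 1) t0.
    by apply: cvgD; [apply: cvgB => //; exact: cvgMr|apply: cvgMr; exact: ce].
  by apply: cvgD; [apply: cvgB => //; exact: cvgMr|exact: cvgMr].
pose D : set R := `[0%R, +oo[%classic.
have intf : (\int[mu]_(x in D) (f x)%:E = C%:E)%E.
  (* Since h' = s k - h and e' = - e, this is a primitive of [f]; it rises from - C at 0 to 0 at
     infinity. *)
  pose F t := - h t - C * e t.
  have dF t : 0 < t -> is_derive t 1 F (f t).
    move=> t0; have ? := dh _ t0; have ? := de t.
    by apply: is_derive_eq; rewrite /f /GRing.scale/=; ring.
  rewrite (@ge0_continuous_FTC2y R f F 0 0).
  - by rewrite /F hz ez -EFinB; congr EFin; ring.
  - exact: f0.
  - exact: cf.
  - have : F x @[x --> +oo] --> - (0 : R) - C * 0.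
      by apply: cvgB; [exact: cvgN|exact: cvgMr].
    by rewrite mulr0 subr0 oppr0.
  - by move=> t t0; have [] := dF _ t0.
  - by apply: cvgB; [exact: cvgN|exact: cvgMr].
  - move=> t; rewrite in_itv/= andbT => t0.
    by rewrite derive1E; have [_ ->] := dF _ t0.
have inte : (\int[mu]_(x in D) (C * e x)%:E = C%:E)%E.
  rewrite (@ge0_continuous_FTC2y R (fun t => C * e t) (fun t => - (C * e t)) 0 0).
  - by rewrite ez mulr1 sub0e EFinN oppeK.
  - by move=> t _; rewrite mulr_ge0.
  - apply/continuous_within_itvcyP; split; last exact: cvgMr.
    by move=> t _; apply: cvgMr; exact: ce.
  - have : (- (C * e x)) @[x --> +oo] --> - (C * (0 : R)).
      by apply: cvgN; exact: cvgMr.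
    by rewrite mulr0 oppr0.
  - by move=> t t0; have ? := de t; apply: ex_derive.
  - by apply: cvgN; exact: cvgMr.
  - move=> t t0; rewrite derive1E; have ? := de t.
    by rewrite derive_val /GRing.scale/=; ring.
have mD : measurable D by exact: measurable_itv.
(* Integrate the pointwise identity h + C e = f + s k, all of whose terms are nonnegative. The
   integrals of [f] and of C e both equal the finite number [C], which then cancels. *)
have fin : (\int[mu]_(x in D) (h x)%:E + C%:E =
            C%:E + s%:E * \int[mu]_(x in D) (k x)%:E)%E.
  rewrite -{1}inte -intf -ge0_integralZl_EFin//; last 3 first.
  - by move=> x _; rewrite lee_fin.
  - by apply/measurable_EFinP; apply: measurable_funTS.
  - exact: ltW.
  rewrite -!ge0_integralD//.
  - by apply: eq_integral => x _; rewrite -EFinM -!EFinD; congr EFin; rewrite /f; ring.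
  - by move=> x; rewrite /D/= in_itv/= andbT => ?; rewrite lee_fin f0.
  - apply/measurable_EFinP; apply: measurable_funTS.
    apply: measurable_funD; last exact: measurable_funM.
    by apply: measurable_funB => //; exact: measurable_funM.
  - by move=> x _; rewrite -EFinM lee_fin mulr_ge0// ltW.
  - apply/measurable_EFinP; apply: measurable_funTS.
    exact: measurable_funM.
  - by move=> x _; rewrite lee_fin.
  - by apply/measurable_EFinP; apply: measurable_funTS.
  - by move=> x _; rewrite lee_fin mulr_ge0.
  - apply/measurable_EFinP; apply: measurable_funTS.
    exact: measurable_funM.
have {}fin : (\int[mu]_(x in D) (h x)%:E = s%:E * \int[mu]_(x in D) (k x)%:E)%E.
  move: fin; rewrite [RHS]addeC => /(congr1 (fun z => z - C%:E)%E).
  by rewrite !addeK.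
have ocE (g : R -> R) : measurable_fun [set: R] g ->
    \int[mu]_(x in `]0%R, +oo[) g x = fine (\int[mu]_(x in D) (g x)%:E).
  move=> mg; rewrite /Rintegral integral_itv_obnd_cbnd//.
  by apply/measurable_EFinP; apply: measurable_funTS.
rewrite /Gamma addrK ocE// ocE// fin.
(* In the infinite cases [fine] returns 0 on both sides, because [s] is positive. *)
move: (\int[mu]_(x in D) (k x)%:E)%E => [r||]//=.
  by rewrite gt0_muley ?lte_fin//= mulr0.
by rewrite gt0_muleNy ?lte_fin//= mulr0.
Qed.

End Gamma.

(** * The L2-1_sigma coefficients *)

Section coefficients.
Context {R : realType}.
Variables (alpha sigma tau : R).
Hypotheses (alpha0 : 0 < alpha) (alpha1 : alpha < 1).
Hypothesis hsigma : sigma = 1 - alpha / 2.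
Hypothesis tau0 : 0 < tau.
Local Notation W := (omega (2 - alpha)).
Local Notation a := (coef_a alpha sigma tau).
Local Notation b := (coef_b alpha sigma tau).
Local Notation g := (coef_g alpha sigma tau).
Implicit Types (t x y : R) (j n : nat).

Local Ltac lra_alpha := move: alpha0 alpha1 => ? ?; lra.

(** First and second derivatives of [omega (2 - alpha)]. They keep the denominator
    [Gamma (2 - alpha)], as [GammaS] covers only arguments above 1. *)
Let W1 t := (1 - alpha) * t `^ (- alpha) / Gamma (2 - alpha).
Let W0 t := - (alpha * (1 - alpha)) * t `^ (- alpha - 1) / Gamma (2 - alpha).

Let iG_ge0 : 0 <= (Gamma (2 - alpha))^-1.
Proof. by rewrite invr_ge0 Gamma_ge0. Qed.

Let is_derive_powR_scale (c p t : R) : 0 < t ->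
  is_derive t 1 (fun x => x `^ p * c) (p * t `^ (p - 1) * c).
Proof.
move=> t0; have ? := is_derive1_powR p t0.
by apply: is_derive_eq; rewrite /GRing.scale/=; ring.
Qed.

(** The functional equation enters here, as Gamma(3 - alpha) = (2 - alpha) Gamma(2 - alpha) with 2 -
    alpha > 1. *)
Let dW3 t : 0 < t -> is_derive t 1 (omega (3 - alpha)) (W t).
Proof.
move=> t0; apply: is_derive_eq; first exact: is_derive_powR_scale.
have -> : 3 - alpha = 2 - alpha + 1 by ring.
rewrite GammaS; last by lra_alpha.
rewrite addrK /omega invfM mulrA; congr (_ * _).
by rewrite mulrAC mulfV ?mul1r// gt_eqF//; lra_alpha.
Qed.

Let dW2 t : 0 < t -> is_derive t 1 W (W1 t).
Proof.
move=> t0; apply: is_derive_eq; first exact: is_derive_powR_scale.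
have -> : 2 - alpha - 1 = 1 - alpha by ring.
by rewrite addrAC subrr add0r.
Qed.

Let dW1 t : 0 < t -> is_derive t 1 W1 (W0 t).
Proof.
move=> t0.
have -> : W1 = fun t => t `^ (- alpha) * ((1 - alpha) / Gamma (2 - alpha)).
  by apply/funext => x; rewrite /W1; ring.
apply: is_derive_eq; first exact: is_derive_powR_scale.
by rewrite /W0; ring.
Qed.

Let W1_ge0 t : 0 < t -> 0 <= W1 t.
Proof.
by move=> _; rewrite mulr_ge0// mulr_ge0 ?powR_ge0//; lra_alpha.
Qed.

Let W0_le0 t : 0 < t -> W0 t <= 0.
Proof.
move=> _; rewrite mulr_le0_ge0// mulr_le0_ge0 ?powR_ge0//.
by rewrite oppr_le0 mulr_ge0; lra_alpha.
Qed.

Let W0_nd x y : 0 < x -> x <= y -> W0 x <= W0 y.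
Proof.
move=> x0 xy; rewrite /W0 ler_wpM2r// ler_wnM2l//.
  by rewrite oppr_le0 mulr_ge0; lra_alpha.
have -> : - alpha - 1 = - (alpha + 1) by ring.
have y0 := lt_le_trans x0 xy.
rewrite !powRN lef_pV2 ?posrE ?powR_gt0//.
by apply: ge0_ler_powR; rewrite ?nnegrE; lra_alpha.
Qed.

Let sigma0 : 0 < sigma. Proof. by rewrite hsigma; lra_alpha. Qed.

Lemma tsig_gt0 n : 0 < tsig sigma tau n.
Proof. by rewrite mulr_gt0// ltr_wpDl. Qed.

Let tsigS n : tsig sigma tau n.+1 = tsig sigma tau n + tau.
Proof. by rewrite /tsig -natr1; ring. Qed.

Let tsig_le n : tsig sigma tau n <= tsig sigma tau n.+1.
Proof. by rewrite tsigS lerDl ltW. Qed.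

Let aS n : a n.+1 = increment W tau (tsig sigma tau n).
Proof. by rewrite /coef_a tsigS. Qed.

Let bS n : b n.+1 = trapezoid_defect (omega (3 - alpha)) W tau (tsig sigma tau n).
Proof. by rewrite /coef_b tsigS. Qed.

Lemma omega_ge0 t : 0 <= W t.
Proof. by rewrite mulr_ge0// powR_ge0. Qed.

Lemma coef_b_ge0 n : 0 <= b n.
Proof.
case: n => // n; rewrite bS.
exact: (trapezoid_defect_ge0 tau0 dW3 dW2 dW1 W0_le0 (tsig_gt0 n)).
Qed.

Lemma coef_b_le n : b n.+1 <= a n.+1 / 2.
Proof.
rewrite bS aS.
exact: (trapezoid_defect_le tau0 dW3 dW2 W1_ge0 (tsig_gt0 n)).
Qed.

(** The comparison starts at index 1, since [b 0] is 0 by convention and is not a trapezoidal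
    error. *)
Lemma coef_b_nincr n : b n.+2 <= b n.+1.
Proof.
rewrite !bS.
exact: (trapezoid_defect_nincr tau0 dW3 dW2 dW1 W0_nd (tsig_gt0 n)).
Qed.

Lemma coef_a_ge0 n : 0 <= a n.
Proof.
case: n => [|n]; last by have := coef_b_ge0 n.+1; have := coef_b_le n; lra_alpha.
by rewrite mulr_ge0 ?omega_ge0// invr_ge0 ltW.
Qed.

Lemma coef_a_sub_b_nincr n : a n.+2 - b n.+2 <= a n.+1 - b n.+1.
Proof.
rewrite !bS !aS.
exact: (increment_sub_defect_nincr tau0 dW3 dW2 dW1 W0_le0 (tsig_gt0 n)).
Qed.

(* By concavity [a_1 <= W'(t_sigma) = (1 - alpha) W(t_sigma) / t_sigma]. *)
Lemma coef_a1_le : sigma ^+ 2 * a 1%N <= (2 * sigma - 1) * a 0%N.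
Proof.
have t0 := tsig_gt0 0.
have H : a 1%N <= W1 (tsig sigma tau 0).
  rewrite aS; exact: (increment_le tau0 dW2 dW1 W0_le0 t0).
have e : sigma * W1 (tsig sigma tau 0) = (1 - alpha) * a 0%N.
  rewrite /W1 /coef_a /omega.
  have -> : 2 - alpha - 1 = 1 - alpha by ring.
  rewrite -(@mulr_powRB1 _ _ (1 - alpha)) ?(ltW t0)//; last by lra_alpha.
  have -> : 1 - alpha - 1 = - alpha by ring.
  rewrite {2}/tsig; move: (Gamma _)^-1 => i.
  by field; rewrite gt_eqF.
(* With this value of [sigma] the right-hand side is exactly sigma W1(t_sigma). What remains is
   sigma a_1 <= W1(t_sigma), which holds since sigma <= 1. *)
have s2 : 2 * sigma - 1 = 1 - alpha by rewrite hsigma; field.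
rewrite s2 -e expr2 -mulrA.
rewrite ler_wpM2l ?(ltW sigma0)//.
have s1 : sigma <= 1 by rewrite hsigma; lra_alpha.
apply: le_trans (_ : sigma * W1 (tsig sigma tau 0) <= _).
  by rewrite ler_wpM2l// ltW.
by rewrite -{2}(mul1r (W1 _)) ler_wpM2r// W1_ge0.
Qed.

Lemma coef_a0 : a 0%N = tau^-1 * W (tsig sigma tau 0).
Proof. by []. Qed.

Lemma sum_coef_a n : tau * \sum_(0 <= j < n.+1) a j = W (tsig sigma tau n).
Proof.
elim: n => [|n ih].
  by rewrite big_nat1 /coef_a mulrA mulfV ?mul1r// gt_eqF.
by rewrite big_nat_recr//= mulrDr ih mulrA mulfV ?gt_eqF// mul1r subrKC.
Qed.

Lemma coef_g00 : g 0%N 0%N = a 0%N.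
Proof. by []. Qed.

Lemma coef_g_lt n j : (j < n)%N -> g n j = a j + b j.+1 - b j.
Proof. by case: n => // n jn; rewrite /coef_g jn. Qed.

(** The case n = 0 is included because [b 0] is 0. *)
Lemma coef_g_last n : g n n = a n - b n.
Proof. by case: n => [|n]; [rewrite subr0|rewrite /coef_g ltnn]. Qed.

(** From b_j <= a_j/2 the part a_j - b_j is nonnegative, and below the last index b_{j+1} >= 0 is
    added. *)
Lemma coef_g_ge0 n j : (j <= n)%N -> 0 <= g n j.
Proof.
rewrite /coef_g; case: n => [|n] jn; first exact: (coef_a_ge0 0).
rewrite [n.+1 == 0%N]/=.
have ab m : 0 <= a m - b m.
  by case: m => [|m]; [rewrite subr0 coef_a_ge0|
    have := coef_a_ge0 m.+1; have := coef_b_le m; lra_alpha].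
case: ifPn => // _; rewrite addrAC addr_ge0//; exact: coef_b_ge0.
Qed.

(** Both a_j - b_j and b_{j+1} are nonincreasing from index 1 on; at the last index the second one
    is replaced by 0, which only lowers the weight. The pair of indices 0 and 1 is left to
    [coef_g1_le]. *)
Lemma coef_g_nincr n j : (j.+2 <= n)%N -> g n j.+2 <= g n j.+1.
Proof.
case: n => // n jn; rewrite /coef_g (_ : (n.+1 == 0%N) = false)// jn.
have := coef_a_sub_b_nincr j; have := coef_b_nincr j.+1.
have := coef_b_ge0 j.+3; have := coef_b_nincr j.
have [_|nj] := ltnP j.+2 n.+1; first by lra.
have -> : n.+1 = j.+2 by apply/eqP; rewrite eqn_leq jn nj.
lra.
Qed.

(** The corrections by [b] go the right way, g_1 <= a_1 and a_0 <= g_0, so that [coef_a1_le]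
    suffices. *)
Lemma coef_g1_le n : sigma ^+ 2 * g n.+1 1%N <= (2 * sigma - 1) * g n.+1 0%N.
Proof.
have nE : (n.+1 == 0%N) = false by [].
have g1 : g n.+1 1%N <= a 1%N.
  rewrite /coef_g nE; have := coef_b_nincr 0; have := coef_b_ge0 1.
  by case: ltnP => [_|]; [lra|case: n {nE} => // _; lra].
have g0 : a 0%N <= g n.+1 0%N.
  by rewrite /coef_g nE/= subr0 lerDl (coef_b_ge0 1).
apply: le_trans (_ : sigma ^+ 2 * a 1%N <= _).
  by rewrite ler_wpM2l// sqr_ge0.
apply: (le_trans coef_a1_le); rewrite ler_wpM2l// hsigma; lra_alpha.
Qed.

End coefficients.

(** * Coercivity of the discrete derivatives *)

(** Summation by parts: the interior coefficients c_{j-1} - c_j, for j >= 2, are nonnegative and are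
    dropped. *)
Lemma weighted_increments_ge (R : realFieldType) (c e : nat -> R) n :
  (forall j, 0 <= e j) ->
  (forall j, (j.+2 <= n.+1)%N -> c j.+2 <= c j.+1) ->
  c 0%N * (e 1%N - e 0%N) - c 1%N * e 1%N + c n.+1 * e n.+2
    <= \sum_(j < n.+2) c j * (e j.+1 - e j).
Proof.
move=> e0; elim: n => [|n ih] cn.
  by rewrite !big_ord_recr big_ord0 /=; lra.
rewrite big_ord_recr/=.
have {}ih := ih (fun j jn => cn j (leq_trans jn (leqnSn _))).
have : c n.+2 * e n.+2 <= c n.+1 * e n.+2 by rewrite ler_wpM2r// cn.
by move: ih; lra.
Qed.

(** The gap between the two sides is half a weighted sum of increments of e_j, the squared distance
    from v_{n+1-j} to the test value [z]. Since e_0 and e_1 are (1 - sigma)^2 and sigma^2 times the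
    same square, the first terms combine into (2 sigma - 1) c_0 - sigma^2 c_1, nonnegative by the
    last hypothesis. *)
Lemma caputo_coercive (R : realFieldType) (sigma : R) (c v : nat -> R) n :
  1 / 2 <= sigma ->
  (forall j, (j <= n)%N -> 0 <= c j) ->
  (forall j, (j.+2 <= n)%N -> c j.+2 <= c j.+1) ->
  ((0 < n)%N -> sigma ^+ 2 * c 1%N <= (2 * sigma - 1) * c 0%N) ->
  2^-1 * \sum_(j < n.+1) c j * (v (n - j).+1 ^+ 2 - v (n - j)%N ^+ 2)
    <= (\sum_(j < n.+1) c j * (v (n - j).+1 - v (n - j)%N))
       * (sigma * v n.+1 + (1 - sigma) * v n).
Proof.
move=> sigma2 c0 cn c1.
set z := sigma * _ + _; pose e j := (z - v (n.+1 - j)%N) ^+ 2.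
(* [2 (x - y) z - (x^2 - y^2) = (z - y)^2 - (z - x)^2] *)
have -> : (\sum_(j < n.+1) c j * (v (n - j).+1 - v (n - j)%N)) * z =
    2^-1 * \sum_(j < n.+1) c j * (v (n - j).+1 ^+ 2 - v (n - j)%N ^+ 2)
    + 2^-1 * \sum_(j < n.+1) c j * (e j.+1 - e j).
  rewrite -mulrDr -big_split/= mulr_suml mulr_sumr; apply: eq_bigr => j _.
  by rewrite /e subSS -subSn; [field|rewrite -ltnS].
rewrite lerDl mulr_ge0//.
have e0 j : 0 <= e j by exact: sqr_ge0.
have e0E : e 0%N = (1 - sigma) ^+ 2 * (v n.+1 - v n) ^+ 2.
  by rewrite /e subn0 /z; ring.
have e1E : e 1%N = sigma ^+ 2 * (v n.+1 - v n) ^+ 2.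
  by rewrite /e subn1 /z; ring.
have d0 : 0 <= (v n.+1 - v n) ^+ 2 by exact: sqr_ge0.
move: d0 e0E e1E; set d := (_ ^+ 2) => d0 e0E e1E.
case: n c0 cn c1 @z @d @e e0 e0E e1E d0 => [|n] c0 cn c1 z d e e0 e0E e1E d0.
  rewrite big_ord1/= mulr_ge0 ?c0// e0E e1E -mulrBl mulr_ge0//.
  by rewrite (_ : _ - _ = 2 * sigma - 1); [lra|ring].
apply: le_trans (weighted_increments_ge e0 cn).
apply: addr_ge0; last by rewrite (mulr_ge0 _ (e0 _))// c0.
rewrite (_ : _ - _ = ((2 * sigma - 1) * c 0%N - sigma ^+ 2 * c 1%N) * d).
  by rewrite mulr_ge0// subr_ge0 c1.
by rewrite e0E e1E; ring.
Qed.

(* [x], [y], [d] are [|U^{n+1}|^2], [|U^n|^2], [|U^{n+1} - U^n|^2]. *)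
Definition bdf_energy (R : realFieldType) (sigma x y d : R) : R :=
  (2 * sigma + 1) * x - (2 * sigma - 1) * y
  + (2 * sigma - 1) * (sigma + 1) * d.

Lemma bdf_coercive (R : realFieldType) (sigma tau x y z : R) :
  1 / 2 <= sigma -> 0 < tau ->
  (4 * tau)^-1 * (bdf_energy sigma (x ^+ 2) (y ^+ 2) ((x - y) ^+ 2)
                - bdf_energy sigma (y ^+ 2) (z ^+ 2) ((y - z) ^+ 2))
  <= ((2 * sigma + 1) / (2 * tau) * (x - y)
     - (2 * sigma - 1) / (2 * tau) * (y - z))
     * (sigma * x + (1 - sigma) * y).
Proof.
move=> s2 t0; rewrite -subr_ge0.
have tN0 : tau != 0 by rewrite gt_eqF.
rewrite [leRHS](_ : _ =
  (4 * tau)^-1 * (sigma * (2 * sigma - 1) * (x - 2 * y + z) ^+ 2)).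
  rewrite mulr_ge0 ?invr_ge0//; first by lra.
  by rewrite (mulr_ge0 _ (sqr_ge0 _))// mulr_ge0//; lra.
by rewrite /bdf_energy; field.
Qed.

(** Turns a bound on the energy back into one on the newest iterate. The weight (2 sigma - 1)(sigma
    + 1) of the increment is what makes the remainder a perfect square. *)
Lemma bdf_energy_ge (R : realFieldType) (sigma x y : R) :
  1 / 2 <= sigma ->
  x ^+ 2 <= sigma * bdf_energy sigma (x ^+ 2) (y ^+ 2) ((x - y) ^+ 2).
Proof.
move=> s2; rewrite -subr_ge0 [leRHS](_ : _ =
  (2 * sigma - 1) * ((sigma + 1) * x - sigma * y) ^+ 2).
  by rewrite (mulr_ge0 _ (sqr_ge0 _))//; lra.
rewrite /bdf_energy; ring.
Qed.

(** * Discrete energy estimate *)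

(* [e = |U^1|^2 + (2 sigma - 1)|U^1 - U^0|^2], [w0] and [w] are the values of
   [omega_{2-alpha}] at [t_sigma] and [t_{n+sigma}], [beta = tau sum_j b_j]. *)
Lemma first_step_absorption (R : realFieldType) (sigma mu w0 w beta x0 e F P : R) :
  1 / 2 <= sigma <= 1 -> 0 <= mu -> 0 <= w0 -> 0 <= beta <= (w - w0) / 2 ->
  0 <= x0 -> 0 <= F -> 0 <= P -> (1 + mu * w0) * (e - x0) <= F ->
  sigma * ((2 * sigma + 1 + 2 * mu * (w0 + beta)) * e
    + (2 * mu * (w - w0 - beta) - (2 * sigma - 1)) * x0 + P)
  <= (3 + mu * w * (5 + mu * w0)) * x0 + (4 + mu * w) * F + 2 * P.
Proof.
move=> /andP[s2 s1] mu0 w00 /andP[b0 bw] x00 F0 P0 eF.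
have muw0 : 0 <= mu * w0 by rewrite mulr_ge0.
have muw : 0 <= mu * w by rewrite mulr_ge0//; lra.
have mub : mu * beta <= mu * ((w - w0) / 2) by rewrite ler_wpM2l.
have mub0 : 0 <= mu * beta by rewrite mulr_ge0.
pose K := 2 * sigma + 1 + 2 * mu * (w0 + beta).
have K0 : 0 <= K by rewrite /K; lra.
have muww : 0 <= (mu * w) * (mu * w0) by rewrite mulr_ge0.
(* If e > x0, the first-step bound applies because K <= 3 + mu w0 + mu w <= (3 + mu w)(1 + mu w0);
   otherwise the left-hand side is nonpositive. *)
have KF : K * (e - x0) <= (3 + mu * w) * F.
  have [ex|ex] := leP e x0.
    apply: (@le_trans _ _ 0); first by rewrite mulr_ge0_le0// subr_le0.
    by rewrite mulr_ge0//; lra.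
  apply: (@le_trans _ _ ((3 + mu * w) * ((1 + mu * w0) * (e - x0)))); last first.
    by rewrite ler_wpM2l//; lra.
  rewrite mulrA ler_wpM2r ?subr_ge0 ?(ltW ex)// /K; lra.
(* The coefficients of [e] and [x0] add up to 2 + 2 mu w: [beta], [w0] and [sigma] cancel. *)
rewrite (_ : _ + _ + P = (2 + 2 * (mu * w)) * x0 + K * (e - x0) + P);
  last by rewrite /K; ring.
have x0w : 0 <= mu * w * x0 by rewrite mulr_ge0.
have x0ww : 0 <= mu * w * (mu * w0) * x0 by rewrite mulr_ge0.
have Fw : 0 <= mu * w * F by rewrite mulr_ge0.
apply: (@le_trans _ _ (sigma * ((2 + 2 * (mu * w)) * x0 + (3 + mu * w) * F + P))).
  by rewrite ler_wpM2l ?lerD2r ?lerD2l//; lra.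
apply: (@le_trans _ _ (1 * ((2 + 2 * (mu * w)) * x0 + (3 + mu * w) * F + P))).
  by rewrite ler_wpM2r//; lra.
lra.
Qed.

#[local] Arguments coef_a : simpl never.
#[local] Arguments coef_b : simpl never.

Section stability.
Context {R : realType}.
Variables (alpha sigma tau lambda1 lambda2 gamma2 : R) (N : nat).
(** Real sequences standing for |U^n|^2, |U^{n+1} - U^n|^2 and |f^{n+sigma}|^2. *)
Variables s d phi : nat -> R.
Hypotheses (alpha0 : 0 < alpha) (alpha1 : alpha < 1).
Hypothesis hsigma : sigma = 1 - alpha / 2.
Hypothesis tau0 : 0 < tau.
Hypotheses (lambda1_gt0 : 0 < lambda1) (lambda2_gt0 : 0 < lambda2).
Hypothesis gamma2_gt0 : 0 < gamma2.
Hypotheses (s_ge0 : forall n, 0 <= s n) (d_ge0 : forall n, 0 <= d n).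
Hypothesis phi_ge0 : forall n, 0 <= phi n.
Local Notation a := (coef_a alpha sigma tau).
Local Notation b := (coef_b alpha sigma tau).
Local Notation g := (coef_g alpha sigma tau).
Local Notation W n := (omega (2 - alpha) (tsig sigma tau n)).
Local Notation mu := (lambda2 / lambda1).
Local Notation H n := (bdf_energy sigma (s n.+1) (s n) (d n)).
Local Notation G n := (\sum_(j < n.+1) g n j * s (n - j).+1).

Hypothesis energy0 :
  (lambda1 / tau + lambda2 * a 0%N) * (s 1%N - s 0%N + (2 * sigma - 1) * d 0%N)
    <= phi 0%N / (2 * gamma2).
Hypothesis energyS : forall n, (n.+1 < N)%N ->
  lambda1 * ((4 * tau)^-1 * (H n.+1 - H n))
  + lambda2 * (2^-1 * \sum_(j < n.+2) g n.+1 j * (s (n.+1 - j).+1 - s (n.+1 - j)%N))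
    <= phi n.+1 / (4 * gamma2).
Hypothesis energy_ge : forall n, (n < N)%N -> s n.+1 <= sigma * H n.

(** Passing from g^n to g^{n+1}, the weight of index n gains b_{n+1} and multiplies [s 1], while the
    new weight a_{n+1} - b_{n+1} multiplies [s 0]. All smaller indices reproduce [G n]. *)
Lemma memory_telescope n :
  \sum_(j < n.+2) g n.+1 j * (s (n.+1 - j).+1 - s (n.+1 - j)%N)
    = G n.+1 - (G n + b n.+1 * s 1%N + (a n.+1 - b n.+1) * s 0%N).
Proof.
under eq_bigr do rewrite mulrBr.
rewrite sumrB; congr (_ - _).
rewrite big_ord_recr/= subnn.
rewrite coef_g_last; congr (_ + _).
rewrite big_ord_recr [in RHS]big_ord_recr/= subnn subSnn -addrA; congr (_ + _).
  apply: eq_bigr => j _; rewrite (subSn (ltnW (ltn_ord j))); congr (_ * _).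
  by rewrite !coef_g_lt ?ltn_ord// ltnW// ltnS ltn_ord.
by rewrite coef_g_lt// coef_g_last; ring.
Qed.

(** The term [a 0] in front of [s 1] is the starting value of the memory sum, [G 0] = a_0 s_1. *)
Lemma energy_sum n : (n < N)%N ->
  lambda1 * ((4 * tau)^-1 * H n) + lambda2 * (2^-1 * G n) <=
  lambda1 * ((4 * tau)^-1 * H 0) + lambda2 * (2^-1 * (
     (a 0%N + \sum_(1 <= j < n.+1) b j) * s 1%N
     + (\sum_(1 <= j < n.+1) (a j - b j)) * s 0%N))
  + (\sum_(1 <= i < n.+1) phi i) / (4 * gamma2).
Proof.
elim: n => [|n ih] nN.
  by rewrite !big_geq// big_ord1/= mul0r !addr0 mul0r addr0.
have := lerD (ih (ltnW nN)) (energyS nN).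
rewrite memory_telescope.
rewrite !(big_nat_recr n.+1)//=.
move: (H n.+1) (H n) (H 0%N) (G n.+1) (G n) => ? ? ? ? ?.
move: (\sum_(1 <= j < n.+1) b j) (\sum_(1 <= j < n.+1) (a j - b j)) => ? ?.
move: (\sum_(1 <= j < n.+1) phi j) (4 * tau)^-1 (4 * gamma2)^-1 => ? ? ?.
rewrite -subr_ge0 => h; rewrite -subr_ge0; apply: le_trans h _.
by rewrite le_eqVlt; apply/orP; left; apply/eqP; ring.
Qed.


Let sigma_itv : 1 / 2 <= sigma <= 1.
Proof. by move: alpha0 alpha1; rewrite hsigma => ? ?; apply/andP; lra. Qed.

Let W_ge0 n : 0 <= W n. Proof. exact: omega_ge0. Qed.

Let mu_ge0 : 0 <= mu. Proof. by rewrite divr_ge0// ltW. Qed.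

Local Notation F := (tau / (2 * lambda1 * gamma2) * phi 0%N).
Local Notation e := (s 1%N + (2 * sigma - 1) * d 0%N).

Let F_ge0 : 0 <= F.
Proof. by rewrite mulr_ge0// divr_ge0 ?mulr_ge0// ltW. Qed.

Let first_step : (1 + mu * W 0) * (e - s 0%N) <= F.
Proof.
have l0 : 0 < tau / lambda1 by rewrite divr_gt0.
have := energy0; rewrite -(ler_pM2l l0).
have -> : tau / lambda1 * (phi 0%N / (2 * gamma2)) = F.
  by field; rewrite !gt_eqF.
apply: le_trans; rewrite le_eqVlt; apply/orP; left; apply/eqP.
rewrite coef_a0.
by move: (W 0) => w; field; rewrite !gt_eqF.
Qed.

Let s1_le : s 1%N <= e.
Proof.
by rewrite lerDl mulr_ge0//; case/andP: sigma_itv => ? ?; lra.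
Qed.

Lemma stability_first : s 1%N <= (1 + mu * W 0) * s 0%N + F.
Proof.
have w0 : 0 <= mu * W 0 by rewrite mulr_ge0.
have ws : 0 <= mu * W 0 * s 0%N by rewrite mulr_ge0.
(* If e <= s_0 the bound is immediate; otherwise the factor 1 + mu W(t_sigma) >= 1 in [first_step]
   may be dropped. *)
have [es|es] := leP e (s 0%N).
  by have ? := s1_le; have ? := F_ge0; lra.
have : 0 <= mu * W 0 * (e - s 0%N) by rewrite mulr_ge0// subr_ge0 ltW.
by have ? := s1_le; have ? := first_step; lra.
Qed.

Lemma stability_next n : (0 < n < N)%N ->
  s n.+1 <= (3 + mu * W n * (5 + mu * W 0)) * s 0%N
    + 2 * tau / (lambda1 * gamma2) *
      ((1 + lambda2 / (4 * lambda1) * W n) * phi 0%N + \sum_(1 <= i < n.+1) phi i).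
Proof.
move=> /andP[n0 nN].
have [sigma_ge sigma_le] := andP sigma_itv.
pose A := \sum_(1 <= j < n.+1) a j; pose B := \sum_(1 <= j < n.+1) b j.
pose P := \sum_(1 <= i < n.+1) phi i.
have P0 : 0 <= P by apply: sumr_ge0.
have B0 : 0 <= B by apply: sumr_ge0 => j _; exact: coef_b_ge0.
have BA : B <= A / 2.
  rewrite mulr_suml; apply: ler_sum_nat => -[//|j] _; exact: coef_b_le.
have tA : tau * A = W n - W 0.
  rewrite -(sum_coef_a _ _ tau0) -(sum_coef_a _ _ tau0 0) big_nat1.
  by rewrite big_ltn// mulrDr addrC addKr.
have ta0 : tau * a 0%N = W 0.
  by rewrite coef_a0 mulrA mulfV ?mul1r// gt_eqF.
have G0 : 0 <= G n.
  by apply: sumr_ge0 => j _; rewrite mulr_ge0// coef_g_ge0// -ltnS.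
(* The initial energy is expressed through [e], the quantity that the first step controls. *)
have H0 : H 0 <= (2 * sigma + 1) * e - (2 * sigma - 1) * s 0%N.
  rewrite /bdf_energy -subr_ge0.
  rewrite [leRHS](_ : _ = (2 * sigma - 1) * sigma * d 0%N); last by ring.
  by rewrite !mulr_ge0//; lra.
(* Drop the nonnegative [G n] from the summed inequality and multiply by 4 tau/lambda1; the sums of
   [a] become values of [W]. *)
have Hn : H n <= H 0 + 2 * mu * ((W 0 + tau * B) * s 1%N
     + (W n - W 0 - tau * B) * s 0%N) + tau / (lambda1 * gamma2) * P.
  have := energy_sum nN; rewrite sumrB -/A -/B -/P => h.
  have {}h : lambda1 * ((4 * tau)^-1 * H n) <= lambda1 * ((4 * tau)^-1 * H 0) +
     lambda2 * (2^-1 * ((a 0%N + B) * s 1%N + (A - B) * s 0%N)) + P / (4 * gamma2).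
    apply: le_trans h; rewrite lerDl mulr_ge0 ?(ltW lambda2_gt0)//.
    by rewrite mulr_ge0.
  have c0 : 0 < 4 * tau / lambda1 by rewrite divr_gt0// mulr_gt0.
  move: h; rewrite -(ler_pM2l c0).
  rewrite -tA -ta0.
  move: (H n) (H 0) (a 0%N) => Hn' H0' a0.
  rewrite [leLHS](_ : _ = Hn'); last by field; rewrite !gt_eqF.
  move=> h; apply: (le_trans h).
  rewrite le_eqVlt; apply/orP; left; apply/eqP; field.
  by rewrite !gt_eqF.
apply: (le_trans (energy_ge nN)).
apply: (@le_trans _ _ (sigma * ((2 * sigma + 1 + 2 * mu * (W 0 + tau * B)) * e
    + (2 * mu * (W n - W 0 - tau * B) - (2 * sigma - 1)) * s 0%N
    + tau / (lambda1 * gamma2) * P))).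
  rewrite ler_wpM2l//; first by lra.
  apply: (le_trans Hn).
  have : 2 * mu * (W 0 + tau * B) * s 1%N <= 2 * mu * (W 0 + tau * B) * e.
    rewrite ler_wpM2l// ?s1_le// mulr_ge0//; first by rewrite mulr_ge0.
    by rewrite addr_ge0// mulr_ge0// ltW.
  by move: H0; move: (H 0) => h0; lra.
have PF : 0 <= tau / (lambda1 * gamma2) * P.
  by rewrite mulr_ge0// divr_ge0 ?mulr_ge0// ltW.
have bW : 0 <= tau * B <= (W n - W 0) / 2.
  rewrite mulr_ge0 ?(ltW tau0)//= -tA -mulrA.
  by rewrite ler_wpM2l// ltW.
apply: (le_trans (first_step_absorption sigma_itv mu_ge0 (W_ge0 0) bW
  (s_ge0 0) F_ge0 PF first_step)).
rewrite -addrA lerD2l le_eqVlt; apply/orP; left; apply/eqP; rewrite -/P.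
by move: (W n) => w; field; rewrite !gt_eqF.
Qed.

End stability.

(** * Integration over the broken mesh *)

Section broken_integral.
Context {R : realType}.
Variables (L : R) (M : nat).
Hypotheses (L0 : 0 < L) (M0 : (0 < M)%N).
Local Notation mu := (@lebesgue_measure R).
Local Notation O := (`]0, L[%classic : set R).
Implicit Types (h w : R -> R) (c : R).

(** [inner L M w1 w2] is by definition [cell_int] of the pointwise product. Isolating the integrand
    allows inequalities between real numbers to be integrated. *)
Definition cell_int h : R :=
  \sum_(m < M) \int[lebesgue_measure]_(x in cell L M m) h x.

Definition cell_integrable h :=
  forall m, (m < M)%N -> mu.-integrable (cell L M m) (EFin \o h).

Let mesh_gt0 : 0 < mesh_size L M.
Proof. by rewrite divr_gt0// ltr0n. Qed.

Let nodeM : node L M M = L.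
Proof. by rewrite /node /mesh_size mulrC divfK// pnatr_eq0 -lt0n. Qed.

Let node_lt m n : (m < n)%N -> node L M m < node L M n.
Proof. by move=> mn; rewrite /node ltr_pM2r// ltr_nat. Qed.

Let node_le m n : (m <= n)%N -> node L M m <= node L M n.
Proof. by move=> mn; rewrite /node ler_pM2r// ler_nat. Qed.

Let node0 : node L M 0 = 0.
Proof. by rewrite /node mul0r. Qed.

Let mO : measurable (O : set (measurableTypeR R)).
Proof. exact: measurable_itv. Qed.

Let measurable_cell m : measurable (cell L M m : set (measurableTypeR R)).
Proof. exact: measurable_itv. Qed.

Lemma cell_subset m : (m < M)%N -> cell L M m `<=` O.
Proof.
move=> mM; apply: subset_itv; rewrite bnd_simp.
- by rewrite -[leLHS]node0 node_le.
- by rewrite -[leRHS]nodeM node_le.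
Qed.

Lemma inL2_integrable w1 w2 : inL2 L w1 -> inL2 L w2 ->
  mu.-integrable O (EFin \o (fun x => w1 x * w2 x)).
Proof.
move=> h1 h2; have /Lfun1_integrable h := Lfun2_mul_Lfun1 h1 h2.
have hO := integrableS measurableT mO (@subsetT _ _) h.
apply: eq_integrable; [exact: mO| |exact: hO].
by move=> x xO /=; rewrite !patchE xO.
Qed.

Lemma cell_integrable_mul w1 w2 : inL2 L w1 -> inL2 L w2 ->
  cell_integrable (fun x => w1 x * w2 x).
Proof.
move=> h1 h2 m mM; apply: integrableS (inL2_integrable h1 h2) => //.
exact: cell_subset.
Qed.

Lemma cell_integrableD h1 h2 : cell_integrable h1 -> cell_integrable h2 ->
  cell_integrable (fun x => h1 x + h2 x).
Proof. by move=> i1 i2 m mM; apply: integrableD (i1 _ mM) (i2 _ mM). Qed.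

Lemma cell_integrableZ c h : cell_integrable h ->
  cell_integrable (fun x => c * h x).
Proof. by move=> i m mM; apply: integrableZl (i _ mM). Qed.

Lemma cell_integrableB h1 h2 : cell_integrable h1 -> cell_integrable h2 ->
  cell_integrable (fun x => h1 x - h2 x).
Proof. by move=> i1 i2 m mM; apply: integrableB (i1 _ mM) (i2 _ mM). Qed.

Lemma cell_integrable_sum n (h : nat -> R -> R) :
  (forall i, (i < n)%N -> cell_integrable (h i)) ->
  cell_integrable (fun x => \sum_(i < n) h i x).
Proof.
elim: n => [_ m mM|n ih hi].
  rewrite (_ : _ \o _ = cst 0%E); first exact: integrable0.
  by apply/funext => x /=; rewrite big_ord0.
rewrite (_ : (fun x => _) = fun x => \sum_(i < n) h i x + h n x).
  by apply: cell_integrableD; [apply: ih => i ?; apply: hi; exact: ltnW|exact: hi].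
by apply/funext => x; rewrite big_ord_recr.
Qed.

Lemma cell_intD h1 h2 : cell_integrable h1 -> cell_integrable h2 ->
  cell_int (fun x => h1 x + h2 x) = cell_int h1 + cell_int h2.
Proof.
move=> i1 i2; rewrite -big_split; apply: eq_bigr => m _.
by rewrite RintegralD// ?i1 ?i2.
Qed.

Lemma cell_intB h1 h2 : cell_integrable h1 -> cell_integrable h2 ->
  cell_int (fun x => h1 x - h2 x) = cell_int h1 - cell_int h2.
Proof.
move=> i1 i2; rewrite -sumrB; apply: eq_bigr => m _.
by rewrite RintegralB// ?i1 ?i2.
Qed.

Lemma cell_intZ c h : cell_integrable h ->
  cell_int (fun x => c * h x) = c * cell_int h.
Proof.
move=> i; rewrite mulr_sumr; apply: eq_bigr => m _.
by rewrite RintegralZl// i.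
Qed.

Lemma cell_int_sum n (h : nat -> R -> R) :
  (forall i, (i < n)%N -> cell_integrable (h i)) ->
  cell_int (fun x => \sum_(i < n) h i x) = \sum_(i < n) cell_int (h i).
Proof.
elim: n => [_|n ih hi].
  rewrite big_ord0 /cell_int big1// => m _.
  by under eq_Rintegral do rewrite big_ord0; rewrite Rintegral_cst// mul0r.
have hi' i : (i < n)%N -> cell_integrable (h i) by move=> ?; apply: hi; exact: ltnW.
rewrite big_ord_recr/= -ih// -cell_intD; last 2 first.
- exact: cell_integrable_sum.
- exact: hi.
by congr cell_int; apply/funext => x; rewrite big_ord_recr.
Qed.

Lemma le_cell_int h1 h2 : cell_integrable h1 -> cell_integrable h2 ->
  (forall x, h1 x <= h2 x) -> cell_int h1 <= cell_int h2.
Proof.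
move=> i1 i2 h12; apply: ler_sum => m _.
by apply: le_Rintegral; rewrite ?i1 ?i2.
Qed.

Lemma cell_int_ge0 h : (forall x, 0 <= h x) -> 0 <= cell_int h.
Proof. by move=> h0; apply: sumr_ge0 => m _; exact: Rintegral_ge0. Qed.

(** The cells are added one at a time from the left; each node passed is a null set. *)
Lemma cell_intE h : mu.-integrable O (EFin \o h) ->
  cell_int h = \int[mu]_(x in O) h x.
Proof.
move=> ih; rewrite /cell_int.
suff : forall m, (m <= M)%N ->
    \int[mu]_(x in `]0, node L M m[) h x = \sum_(i < m) \int[mu]_(x in cell L M i) h x.
  by move=> /(_ M (leqnn M)); rewrite nodeM => ->.
elim=> [_|m im mM].
  by rewrite node0 set_itvoo0 Rintegral_set0 big_ord0.
rewrite big_ord_recr/= -im 1?ltnW//.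
have im1 : mu.-integrable `]0, node L M m.+1[ (EFin \o h).
  apply: integrableS ih => //; apply: subset_itvl.
  by rewrite bnd_simp -[leRHS]nodeM node_le.
have im0 : mu.-integrable `]0, node L M m[ (EFin \o h).
  apply: integrableS im1 => //.
  by apply: subset_itvl; rewrite bnd_simp node_le.
rewrite (Rintegral_itv_bndo_bndc im0) /cell.
rewrite -(@Rintegral_itvB _ _ _ _ (node L M m) im1) ?bnd_simp.
- by rewrite subrKC.
- by rewrite -[leLHS]node0 node_le.
- by rewrite node_lt.
Qed.

Lemma inner_norm w : inL2 L w -> inner L M w w = L2norm L w ^+ 2.
Proof.
move=> hw; transitivity (cell_int (fun x => w x * w x)) => //.
rewrite cell_intE; last exact: inL2_integrable.
move: (hw); rewrite /inL2 inE => /andP[_]; rewrite inE/= /finite_norm => fN.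
rewrite /L2norm.
have N0 := @Lnorm_ge0 _ _ _ mu 2%:E (EFin \o (w \_ O)).
have Nfin : ('N[mu]_2%:E[EFin \o (w \_ O)] \is a fin_num)%E by rewrite ge0_fin_numE.
have := @poweR_Lnorm _ _ _ mu (EFin \o (w \_ O)) 2.
rewrite pnatr_eq0 => /(_ isT).
rewrite -{1}(fineK Nfin) poweR_EFin powR_mulrn ?fine_ge0// => /(congr1 fine)/= ->.
rewrite /Rintegral [in LHS]integral_mkcond; congr fine.
apply: eq_integral => x _; rewrite /= !patchE.
case: ifP => _; rewrite /= powR_mulrn ?normr_ge0//.
- by rewrite real_normK ?num_real// expr2.
- by rewrite normr0 expr0n.
Qed.

End broken_integral.

(** * The discrete space, coercivity of the bilinear form and Young's inequality *)

Section function_spaces.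
Context {R : realType}.
Variables (L : R) (M k : nat).
Hypotheses (L0 : 0 < L) (M0 : (0 < M)%N).
Local Notation O := (`]0, L[%classic : set R).
Implicit Types (w : R -> R) (c : R).

Let one_le2 : (1 <= 2%:E :> \bar R)%E.
Proof. by rewrite lee_fin ler1n. Qed.

Lemma inL2_axpy c w1 w2 : inL2 L w1 -> inL2 L w2 ->
  inL2 L (fun x => c * w1 x + w2 x).
Proof.
move=> h1 h2; rewrite /inL2.
have -> : (fun x => c * w1 x + w2 x) \_ O = c *: (w1 \_ O) + (w2 \_ O).
  apply/funext => x; rewrite patchE /GRing.add/= /GRing.scale/= !patchE.
  by case: ifP => _ //; rewrite /GRing.scale/= mulr0 addr0.
exact: (Lfun_submod_closed (@lebesgue_measure R) one_le2).2.
Qed.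

Lemma inL2_0 : inL2 L (fun=> 0).
Proof.
rewrite /inL2 (_ : _ \_ O = 0); last by apply/funext => x; rewrite patchE; case: ifP.
exact: (Lfun_submod_closed (@lebesgue_measure R) one_le2).1.
Qed.

Lemma inL2_comb c1 c2 w1 w2 : inL2 L w1 -> inL2 L w2 ->
  inL2 L (fun x => c1 * w1 x + c2 * w2 x).
Proof.
move=> h1 h2; apply: inL2_axpy => //.
by have := inL2_axpy c2 h2 inL2_0; under eq_fun do rewrite addr0.
Qed.

Lemma inL2_sum n (c : nat -> R) (w : nat -> R -> R) :
  (forall i, (i < n)%N -> inL2 L (w i)) ->
  inL2 L (fun x => \sum_(i < n) c i * w i x).
Proof.
elim: n => [_|n ih hw]; first by under eq_fun do rewrite big_ord0; exact: inL2_0.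
under eq_fun do rewrite big_ord_recr/= addrC.
by apply: inL2_axpy; [exact: hw|apply: ih => i /ltnW; exact: hw].
Qed.

(** Makes U^{n,sigma} an admissible test function. *)
Lemma inV_comb c1 c2 w1 w2 : inV L M k w1 -> inV L M k w2 ->
  inV L M k (fun x => c1 * w1 x + c2 * w2 x).
Proof.
move=> [l1 p1 z1 L1] [l2 p2 z2 L2]; split.
- exact: inL2_comb.
- move=> m mM; have [q1 s1 e1] := p1 m mM; have [q2 s2 e2] := p2 m mM.
  exists (c1 *: q1 + c2 *: q2).
    rewrite (leq_trans (size_polyD _ _))// geq_max.
    by rewrite !(leq_trans (size_scale_leq _ _)).
  by move=> x xm; rewrite e1// e2// !hornerE.
- have : (c1 * w1 x + c2 * w2 x) @[x --> (0 : R)^'+] --> c1 * 0 + c2 * 0.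
    by apply: cvgD; exact: cvgMr.
  by rewrite !mulr0 addr0.
- have : (c1 * w1 x + c2 * w2 x) @[x --> L^'-] --> c1 * 0 + c2 * 0.
    by apply: cvgD; exact: cvgMr.
  by rewrite !mulr0 addr0.
Qed.

(* The interface terms of [Bh] are skew-symmetric apart from the penalty. *)
Lemma Bh_ge (gamma1 gamma2 : R) (vsigma : nat -> R) w :
  0 <= gamma1 -> (forall m, (m <= M)%N -> 0 < vsigma m) ->
  gamma2 * inner L M w w <= Bh L M gamma1 gamma2 vsigma w w.
Proof.
move=> g1 vs; rewrite /Bh [\sum_(m < _) (_ - _)]big1; last by move=> m _; rewrite subrr.
rewrite mulr0 addr0 -addrA addrCA lerDl addr_ge0//.
  rewrite mulr_ge0//; apply: sumr_ge0 => m _.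
  by apply: Rintegral_ge0 => x _; rewrite -expr2 sqr_ge0.
apply: sumr_ge0 => m _; rewrite -mulrA -expr2 mulr_ge0 ?sqr_ge0//.
rewrite divr_ge0 ?divr_ge0 ?(ltW L0) ?ler0n//.
by rewrite ltW// vs// -ltnS.
Qed.

(** Pointwise, the difference of the two sides is (w1 - 2 gamma2 w2)^2 / (4 gamma2). *)
Lemma young_inner (gamma2 : R) w1 w2 : 0 < gamma2 -> inL2 L w1 -> inL2 L w2 ->
  inner L M w1 w2 - gamma2 * inner L M w2 w2 <= L2norm L w1 ^+ 2 / (4 * gamma2).
Proof.
move=> g0 h1 h2; rewrite -(inner_norm L0 M0)// [leRHS]mulrC.
have i11 := cell_integrable_mul L0 M0 h1 h1.
have i12 := cell_integrable_mul L0 M0 h1 h2.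
have i22 := cell_integrable_mul L0 M0 h2 h2.
have ig := cell_integrableZ gamma2 i22.
have -> : gamma2 * inner L M w2 w2 = cell_int L M (fun x => gamma2 * (w2 x * w2 x)).
  by rewrite cell_intZ.
have -> : (4 * gamma2)^-1 * inner L M w1 w1
    = cell_int L M (fun x => (4 * gamma2)^-1 * (w1 x * w1 x)).
  by rewrite cell_intZ.
rewrite -[inner _ _ _ _]/(cell_int L M (fun x => w1 x * w2 x)).
rewrite -cell_intB//; apply: le_cell_int.
- exact: cell_integrableB.
- exact: cell_integrableZ.
- move=> x; rewrite -subr_ge0.
  rewrite [leRHS](_ : _ = (4 * gamma2)^-1 * (w1 x - 2 * gamma2 * w2 x) ^+ 2).
    by rewrite mulr_ge0 ?sqr_ge0// invr_ge0 mulr_ge0// ltW.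
  by field; rewrite gt_eqF.
Qed.

Lemma cell_integrable_bdf (sigma : R) (h1 h2 h3 : R -> R) :
  cell_integrable L M h1 -> cell_integrable L M h2 -> cell_integrable L M h3 ->
  cell_integrable L M (fun x => bdf_energy sigma (h1 x) (h2 x) (h3 x)).
Proof.
move=> i1 i2 i3; apply: cell_integrableD; last exact: cell_integrableZ.
by apply: cell_integrableB; exact: cell_integrableZ.
Qed.

Lemma cell_int_bdf (sigma : R) (h1 h2 h3 : R -> R) :
  cell_integrable L M h1 -> cell_integrable L M h2 -> cell_integrable L M h3 ->
  cell_int L M (fun x => bdf_energy sigma (h1 x) (h2 x) (h3 x))
  = bdf_energy sigma (cell_int L M h1) (cell_int L M h2) (cell_int L M h3).
Proof.
move=> i1 i2 i3; rewrite /bdf_energy cell_intD ?cell_intB ?cell_intZ//.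
all: do ?[apply: cell_integrableB]; exact: cell_integrableZ.
Qed.

End function_spaces.

(** * Stability of the scheme *)

Section scheme.
Context {R : realType}.
Variables (alpha sigma L T lambda1 lambda2 gamma1 gamma2 : R).
Variables (M N k : nat) (vsigma : nat -> R) (f : R -> R -> R) (U : nat -> R -> R).
Hypotheses (alpha0 : 0 < alpha) (alpha1 : alpha < 1).
Hypothesis hsigma : sigma = 1 - alpha / 2.
Hypotheses (L0 : 0 < L) (T0 : 0 < T).
Hypotheses (lambda1_gt0 : 0 < lambda1) (lambda2_gt0 : 0 < lambda2).
Hypotheses (gamma1_gt0 : 0 < gamma1) (gamma2_gt0 : 0 < gamma2).
Hypotheses (M0 : (0 < M)%N) (N0 : (0 < N)%N).
Hypothesis hvsigma : forall m, (m <= M)%N -> 0 < vsigma m.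
Hypothesis hf : continuousL2 L T f.
Hypothesis hU : nipg_solution alpha sigma L T M N k lambda1 lambda2 gamma1
  gamma2 vsigma f U.
Let tau := T / N%:R.
Local Notation t := (tsig sigma tau).
Local Notation I := (cell_int L M).
Local Notation Q := (cell_integrable L M).
Local Notation w := (theta_avg sigma U).
Local Notation g := (coef_g alpha sigma tau).
Local Notation S i := (fun x : R => U i x * U i x).
Local Notation D i := (fun x : R => delta U i x * delta U i x).

Let tau0 : 0 < tau. Proof. by rewrite divr_gt0// ltr0n. Qed.

Let sigma_ge : 1 / 2 <= sigma.
Proof. by move: alpha1; rewrite hsigma => ?; lra. Qed.

Let inL2_U n : (n <= N)%N -> inL2 L (U n).
Proof. by case: hU => h _ /h []. Qed.

Let inL2_f n : (n < N)%N -> inL2 L (f (t n)).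
Proof.
move=> nN; apply: hf.1; rewrite in_itv/=.
rewrite ltW; last by apply: tsig_gt0 alpha0 alpha1 hsigma tau0 n.
rewrite /tsig /tau mulrCA -[leRHS]mulr1 ler_pM2l// ler_pdivrMr ?ltr0n// mul1r.
rewrite (@le_trans _ _ n.+1%:R) ?ler_nat// -natr1 lerD2l.
by move: alpha0; rewrite hsigma => ?; lra.
Qed.

Let inV_w n : (n < N)%N -> inV L M k (w n).
Proof. by case: hU => h _ nN; apply: inV_comb; apply: h => //; exact: ltnW. Qed.

Let inL2_w n : (n < N)%N -> inL2 L (w n).
Proof. by move=> /inV_w[]. Qed.

Let inL2_delta n : (n < N)%N -> inL2 L (delta U n).
Proof.
move=> nN; have := inL2_comb 1 (- 1) (inL2_U nN) (inL2_U (ltnW nN)).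
by under eq_fun do rewrite mul1r mulN1r.
Qed.

Let inL2_delta_t n : (n < N)%N -> inL2 L (delta_t sigma tau U n).
Proof.
case: n => [|n] nN.
  have := inL2_comb tau^-1 0 (inL2_delta nN) (inL2_delta nN).
  by under eq_fun do rewrite mul0r addr0 mulrC.
have := inL2_comb ((2 * sigma + 1) / (2 * tau)) (- ((2 * sigma - 1) / (2 * tau)))
  (inL2_delta nN) (inL2_delta (ltnW nN)).
by under eq_fun do rewrite mulNr.
Qed.

Let inL2_delta_alpha n : (n < N)%N -> inL2 L (delta_alpha alpha sigma tau U n).
Proof.
move=> nN.
apply: (@inL2_sum _ _ n.+1 (g n) (fun j => delta U (n - j)%N)) => j _.
by apply: inL2_delta; rewrite (leq_ltn_trans (leq_subr _ _)).
Qed.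

Let energy_inequality n : (n < N)%N ->
  I (fun x => lambda1 * (delta_t sigma tau U n x * w n x)
              + lambda2 * (delta_alpha alpha sigma tau U n x * w n x))
    <= L2norm L (f (t n)) ^+ 2 / (4 * gamma2).
Proof.
move=> nN.
have Q1 := cell_integrable_mul L0 M0 (inL2_delta_t nN) (inL2_w nN).
have Q2 := cell_integrable_mul L0 M0 (inL2_delta_alpha nN) (inL2_w nN).
rewrite cell_intD ?cell_intZ//; try exact: cell_integrableZ.
apply: le_trans (young_inner L0 M0 gamma2_gt0 (inL2_f nN) (inL2_w nN)).
have := hU.2 n nN (w n) (inV_w nN); rewrite -/tau => <-.
have := Bh_ge L0 gamma2 (w n) (ltW gamma1_gt0) hvsigma.
rewrite -![inner _ _ _ (w n)]/(I _).
by move: (Bh _ _ _ _ _ _ _) (I _) (I _) (I _) => ? ? ? ?; lra.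
Qed.

Let Q_S n : (n <= N)%N -> Q (S n).
Proof. by move=> nN; apply: cell_integrable_mul => //; exact: inL2_U. Qed.

Let Q_D n : (n < N)%N -> Q (D n).
Proof. by move=> nN; apply: cell_integrable_mul => //; exact: inL2_delta. Qed.

Let s n := L2norm L (U n) ^+ 2.
Let d n := I (D n).
Let phi n := L2norm L (f (t n)) ^+ 2.

Let I_S n : (n <= N)%N -> I (S n) = s n.
Proof. by move=> nN; rewrite /s -(inner_norm L0 M0 (inL2_U nN)). Qed.

Let energy0 :
  (lambda1 / tau + lambda2 * coef_a alpha sigma tau 0)
    * (s 1%N - s 0%N + (2 * sigma - 1) * d 0%N) <= phi 0%N / (2 * gamma2).
Proof.
have := energy_inequality N0.
set c := lambda1 / tau + _.
(* At the first step both discrete derivatives are multiples of U^1 - U^0, and 2 (x - y)(sigma x +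
   (1 - sigma) y) = x^2 - y^2 + (2 sigma - 1)(x - y)^2 is exact. *)
have -> : (fun x => lambda1 * (delta_t sigma tau U 0 x * w 0%N x)
              + lambda2 * (delta_alpha alpha sigma tau U 0 x * w 0%N x))
  = fun x => c / 2 * (S 1%N x - S 0%N x + (2 * sigma - 1) * D 0%N x).
  apply/funext => x; rewrite /delta_alpha big_ord1 coef_g00 /= /theta_avg /delta /c.
  by move: (coef_a _ _ _ _) => a; field; rewrite gt_eqF.
have Q1 := cell_integrableB (Q_S N0) (Q_S (leq0n N)).
have Q2 := cell_integrableZ (2 * sigma - 1) (Q_D N0).
rewrite cell_intZ; last exact: cell_integrableD.
rewrite cell_intD// (cell_intB (Q_S N0) (Q_S (leq0n N))) (cell_intZ _ (Q_D N0)).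
rewrite !I_S// -/(d 0) -/(phi 0).
move: (_ + _ * d 0%N) (phi 0%N) => e p.
(* Doubling removes the 1/2 of [c / 2] and turns 4 gamma2 into 2 gamma2. *)
rewrite -(ler_pM2l (ltr0Sn R 1)) => h.
rewrite (_ : c * e = 2 * (c / 2 * e)); last by field.
apply: (le_trans h); rewrite le_eqVlt; apply/orP; left; apply/eqP.
by field; rewrite gt_eqF.
Qed.

Let energyS n : (n.+1 < N)%N ->
  lambda1 * ((4 * tau)^-1 * (bdf_energy sigma (s n.+2) (s n.+1) (d n.+1)
                           - bdf_energy sigma (s n.+1) (s n) (d n)))
  + lambda2 * (2^-1 * \sum_(j < n.+2) g n.+1 j * (s (n.+1 - j).+1 - s (n.+1 - j)%N))
    <= phi n.+1 / (4 * gamma2).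
Proof.
move=> nN; have nN' := ltnW nN; have nN'' := ltnW nN'.
apply: le_trans (energy_inequality nN).
have Q1 := cell_integrable_mul L0 M0 (inL2_delta_t nN) (inL2_w nN).
have Q2 := cell_integrable_mul L0 M0 (inL2_delta_alpha nN) (inL2_w nN).
have QH m : (m < N)%N -> Q (fun x => bdf_energy sigma (S m.+1 x) (S m x) (D m x)).
  move=> mN; apply: cell_integrable_bdf;
    [exact: Q_S|apply: Q_S; exact: ltnW|exact: Q_D].
have IH m : (m < N)%N -> I (fun x => bdf_energy sigma (S m.+1 x) (S m x) (D m x))
    = bdf_energy sigma (s m.+1) (s m) (d m).
  move=> mN; have mN' := ltnW mN.
  by rewrite (cell_int_bdf sigma (Q_S mN) (Q_S mN') (Q_D mN)) !I_S.
have jN j : (n.+1 - j < N)%N by rewrite (leq_ltn_trans (leq_subr _ _)).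
have Qj j : Q (fun x => S (n.+1 - j).+1 x - S (n.+1 - j)%N x).
  by apply: cell_integrableB; apply: Q_S; [|exact: ltnW].
have QG := @cell_integrable_sum _ L M n.+2
  (fun j x => g n.+1 j * (S (n.+1 - j).+1 x - S (n.+1 - j)%N x))
  (fun j _ => cell_integrableZ _ (Qj j)).
have QHH := cell_integrableB (QH _ nN) (QH _ nN').
rewrite -!IH//.
have -> : \sum_(j < n.+2) g n.+1 j * (s (n.+1 - j).+1 - s (n.+1 - j)%N) =
   I (fun x => \sum_(j < n.+2) g n.+1 j * (S (n.+1 - j).+1 x - S (n.+1 - j)%N x)).
  rewrite (@cell_int_sum _ L M n.+2
    (fun j x => g n.+1 j * (S (n.+1 - j).+1 x - S (n.+1 - j)%N x))
    (fun j _ => cell_integrableZ _ (Qj j))).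
  apply: eq_bigr => j _; have jN' := ltnW (jN j).
  by rewrite (cell_intZ _ (Qj j)) (cell_intB (Q_S (jN j)) (Q_S jN')) !I_S.
have Q3 := cell_integrableZ (4 * tau)^-1 QHH.
have Q4 := cell_integrableZ 2^-1 QG.
rewrite -(cell_intB (QH _ nN) (QH _ nN')) -(cell_intZ _ QHH) -(cell_intZ _ Q3).
rewrite -(cell_intZ _ QG) -(cell_intZ _ Q4).
rewrite -(cell_intD (cell_integrableZ _ Q3) (cell_integrableZ _ Q4)).
(* Each side is now a single cell integral, so the scalar coercivity inequalities apply at every
   point x to the sequence U^n(x). *)
apply: le_cell_int.
- by apply: cell_integrableD; exact: cell_integrableZ.
- by apply: cell_integrableD; exact: cell_integrableZ.
move=> x; apply: lerD; rewrite ler_wpM2l ?(ltW lambda1_gt0) ?(ltW lambda2_gt0)//.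
  by rewrite -!expr2; exact: bdf_coercive.
have := @caputo_coercive R sigma (g n.+1) (U ^~ x) n.+1 sigma_ge
  (coef_g_ge0 alpha0 alpha1 hsigma tau0 (n := n.+1))
  (coef_g_nincr alpha0 alpha1 hsigma tau0 (n := n.+1))
  (fun _ => coef_g1_le alpha0 alpha1 hsigma tau0 n).
by under eq_bigr do rewrite !expr2.
Qed.

Let energy_ge n : (n < N)%N ->
  s n.+1 <= sigma * bdf_energy sigma (s n.+1) (s n) (d n).
Proof.
move=> nN; have nN' := ltnW nN.
have QH : Q (fun x => bdf_energy sigma (S n.+1 x) (S n x) (D n x)).
  by apply: cell_integrable_bdf; [exact: Q_S|exact: Q_S|exact: Q_D].
rewrite -!I_S// /d -(cell_int_bdf sigma (Q_S nN) (Q_S nN') (Q_D nN)) -cell_intZ//.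
apply: le_cell_int; [exact: Q_S|exact: cell_integrableZ|].
by move=> x; rewrite -!expr2; exact: bdf_energy_ge.
Qed.

Let s_ge0 n : 0 <= s n. Proof. exact: sqr_ge0. Qed.
Let phi_ge0 n : 0 <= phi n. Proof. exact: sqr_ge0. Qed.
Let d_ge0 n : 0 <= d n.
Proof. by apply: cell_int_ge0 => x; rewrite -expr2 sqr_ge0. Qed.

Lemma scheme_stability_first :
  L2norm L (U 1%N) ^+ 2 <=
    (1 + lambda2 / lambda1 * omega (2 - alpha) (t 0%N)) * L2norm L (U 0%N) ^+ 2
    + tau / (2 * lambda1 * gamma2) * L2norm L (f (t 0%N)) ^+ 2.
Proof.
exact: (stability_first alpha0 alpha1 hsigma tau0 lambda1_gt0 lambda2_gt0
  gamma2_gt0 s_ge0 d_ge0 phi_ge0 energy0).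
Qed.

Lemma scheme_stability_next n : (0 < n < N)%N ->
  L2norm L (U n.+1) ^+ 2 <=
    (3 + lambda2 / lambda1 * omega (2 - alpha) (t n)
         * (5 + lambda2 / lambda1 * omega (2 - alpha) (t 0%N)))
      * L2norm L (U 0%N) ^+ 2
    + 2 * tau / (lambda1 * gamma2)
      * ((1 + lambda2 / (4 * lambda1) * omega (2 - alpha) (t n))
           * L2norm L (f (t 0%N)) ^+ 2
         + \sum_(1 <= i < n.+1) L2norm L (f (t i)) ^+ 2).
Proof.
exact: (stability_next alpha0 alpha1 hsigma tau0 lambda1_gt0 lambda2_gt0
  gamma2_gt0 s_ge0 d_ge0 phi_ge0 energy0 energyS energy_ge).
Qed.

End scheme.

Theorem theorem3p3 (R : realType)
    (alpha sigma L T lambda1 lambda2 gamma1 gamma2 : R)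
    (M N k : nat) (vsigma : nat -> R)
    (f : R -> R -> R) (U : nat -> R -> R)
    (halpha : 0 < alpha < 1) (hsigma : sigma = 1 - alpha / 2)
    (hL : 0 < L) (hT : 0 < T)
    (hlambda1 : 0 < lambda1) (hlambda2 : 0 < lambda2)
    (hgamma1 : 0 < gamma1) (hgamma2 : 0 < gamma2)
    (hM : (0 < M)%N) (hN : (0 < N)%N) (hk : (1 <= k)%N)
    (hvsigma : forall m, (m <= M)%N -> 0 < vsigma m)
    (hf : continuousL2 L T f)
    (hU : nipg_solution alpha sigma L T M N k lambda1 lambda2 gamma1 gamma2
            vsigma f U) :
  let tau := T / N%:R in
  let t := tsig sigma tau in
  L2norm L (U 1%N) ^+ 2 <=
    (1 + lambda2 / lambda1 * omega (2 - alpha) (t 0%N))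
      * L2norm L (U 0%N) ^+ 2
    + tau / (2 * lambda1 * gamma2) * L2norm L (f (t 0%N)) ^+ 2
  /\
  forall n, (1 <= n <= N - 1)%N ->
    L2norm L (U n.+1) ^+ 2 <=
      (3 + lambda2 / lambda1 * omega (2 - alpha) (t n)
           * (5 + lambda2 / lambda1 * omega (2 - alpha) (t 0%N)))
        * L2norm L (U 0%N) ^+ 2
      + 2 * tau / (lambda1 * gamma2)
        * ((1 + lambda2 / (4 * lambda1) * omega (2 - alpha) (t n))
             * L2norm L (f (t 0%N)) ^+ 2
           + \sum_(1 <= i < n.+1) L2norm L (f (t i)) ^+ 2).
Proof.
have [alpha0 alpha1] := andP halpha.
split; first exact: (scheme_stability_first alpha0 alpha1 hsigma hL hT hlambda1
  hlambda2 hgamma1 hgamma2 hM hN hvsigma hf hU).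
move=> n /andP[n0 nN].
apply: (scheme_stability_next alpha0 alpha1 hsigma hL hT hlambda1 hlambda2
  hgamma1 hgamma2 hM hN hvsigma hf hU).
by rewrite n0 -(subnK hN) addn1 ltnS.
Qed.
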